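(* Let $n\ge 3$ and let $GVB_n'$ denote the commutator subgroup of the generalized virtual braid group $GVB_n$. Then: (i) $GVB_n'$ is finitely generated for all $n\ge 4$. Further, for $n\ge 5$, the rank of $GVB_n'$ is at most $3n-7$. (ii) $GVB_3'$ is not finitely generated. (iii) $GVB_n'$ is perfect if and only if $n\ge 5$.
   Context: For $n\ge 3$, the generalized virtual braid group $GVB_n$ is the group with $2(n-1)$ generators $\sigma_i,\rho_i$ ($1\le i\le n-1$) and the following defining relations (for all indices for which they make sense, i.e. all indices lie in $\{1,\dots,n-1\}$): $\sigma_i\sigma_j=\sigma_j\sigma_i$ if $|i-j|>1$; $\sigma_i\sigma_{i+1}\sigma_i=\sigma_{i+1}\sigma_i\sigma_{i+1}$; $\rho_i\rho_j=\rho_j\rho_i$ if $|i-j|>1$; $\rho_i\rho_{i+1}\rho_i=\rho_{i+1}\rho_i\rho_{i+1}$; $\rho_i\sigma_{i+1}\sigma_i=\sigma_{i+1}\sigma_i\rho_{i+1}$; $\rho_{i+1}\sigma_i\sigma_{i+1}=\sigma_i\sigma_{i+1}\rho_i$; $\sigma_i\rho_j=\rho_j\sigma_i$ if $|i-j|>1$. For a group $G$, $G'=[G,G]$ is the commutator subgroup, generated by all $x^{-1}y^{-1}xy$ with $x,y\in G$. A group $H$ is perfect if $H=H'$. The rank of a finitely generated group is the minimal cardinality of a generating set. *)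

(* Defs.v *)
From HB Require Import structures.
From mathcomp Require Import all_boot.
From mathcomp Require Import boolp classical_sets cardinality.

Set Implicit Arguments.
Unset Strict Implicit.
Unset Printing Implicit Defensive.

Local Open Scope group_scope.
Local Open Scope classical_set_scope.
Local Open Scope card_scope.

(* A letter (x, false) stands for the generator x, and (x, true) for x^-1. *)
Definition word (X : Type) := seq (X * bool).

Definition letter_inv (X : Type) (a : X * bool) : X * bool := (a.1, ~~ a.2).

Definition word_inv (X : Type) (w : word X) : word X :=
  rev (map (@letter_inv X) w).

Inductive word_eq (X : Type) (R : word X -> word X -> Prop) :
    word X -> word X -> Prop :=
| word_eq_refl u : word_eq R u u
| word_eq_sym u v : word_eq R u v -> word_eq R v u
| word_eq_trans u v w : word_eq R u v -> word_eq R v w -> word_eq R u w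
| word_eq_cat u u' v v' :
    word_eq R u u' -> word_eq R v v' -> word_eq R (u ++ v) (u' ++ v')
| word_eq_cancel a : word_eq R [:: a; letter_inv a] [::]
| word_eq_rel u v : R u v -> word_eq R u v.

Section PresentedGroup.
Context (X : choiceType) (R : word X -> word X -> Prop).

Definition word_eqb : rel (word X) := fun u v => `[< word_eq R u v >].

Lemma word_eqb_equiv : equiv_class_of word_eqb.
Proof.
split=> [u|u v|v u w].
- exact/asboolP/word_eq_refl.
- by apply/asboolP/asboolP; exact: word_eq_sym.
- by move=> /asboolP uv /asboolP vw; apply/asboolP/(word_eq_trans uv vw).
Qed.

Canonical word_eqb_equiv_rel := EquivRelPack word_eqb_equiv.

Local Open Scope quotient_scope.

(* The group < X | u = v for all u, v with R u v >. *)
Definition presented := {eq_quot word_eqb}.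

HB.instance Definition _ := Choice.copy presented {eq_quot word_eqb}.
HB.instance Definition _ : EqQuotient _ word_eqb presented :=
  EqQuotient.on presented.

Definition pres_class (w : word X) : presented := \pi_presented w.

Lemma pres_classP u v : pres_class u = pres_class v <-> word_eq R u v.
Proof.
split=> [/eqmodP/asboolP//|uv].
by apply/eqmodP/asboolP.
Qed.

Lemma pres_reprK (g : presented) : pres_class (repr g) = g.
Proof. exact: reprK. Qed.

Lemma repr_pres_class w : word_eq R (repr (pres_class w)) w.
Proof. by apply/pres_classP; rewrite pres_reprK. Qed.

Definition pres_one : presented := pres_class [::].
Definition pres_mul (g h : presented) : presented :=
  pres_class (repr g ++ repr h).
Definition pres_inv (g : presented) : presented :=
  pres_class (word_inv (repr g)).

Lemma word_inv_cancel w : word_eq R (w ++ word_inv w) [::].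
Proof.
elim: w => [|a w IHw]; first exact: word_eq_refl.
rewrite /word_inv /= rev_cons -cats1 -/(word_inv w) -cat_cons catA.
apply: word_eq_trans (word_eq_cancel R a).
rewrite -[X in word_eq R _ X]/([:: a] ++ [:: letter_inv a]).
apply: word_eq_cat; last exact: word_eq_refl.
rewrite -cat1s -[X in word_eq R _ X]cats0 -catA.
by apply: word_eq_cat; first exact: word_eq_refl.
Qed.

Lemma word_invK (w : word X) : word_inv (word_inv w) = w.
Proof.
rewrite /word_inv map_rev revK -map_comp map_id_in // => -[x b] _.
by rewrite /letter_inv /= negbK.
Qed.

Lemma pres_mulE u v :
  pres_mul (pres_class u) (pres_class v) = pres_class (u ++ v).
Proof. by apply/pres_classP/word_eq_cat; exact: repr_pres_class. Qed.

Lemma pres_mulA : associative pres_mul.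
Proof.
move=> g h k; rewrite -(pres_reprK g) -(pres_reprK h) -(pres_reprK k).
by rewrite !pres_mulE catA.
Qed.

Lemma pres_mul1 : left_id pres_one pres_mul.
Proof. by move=> g; rewrite -(pres_reprK g) pres_mulE. Qed.

Lemma pres_mulr1 : right_id pres_one pres_mul.
Proof. by move=> g; rewrite -(pres_reprK g) pres_mulE cats0. Qed.

Lemma pres_mulV : left_inverse pres_one pres_inv pres_mul.
Proof.
move=> g; rewrite -{2}(pres_reprK g) /pres_inv pres_mulE.
apply/pres_classP; rewrite -{2}[repr g]word_invK; exact: word_inv_cancel.
Qed.

Lemma pres_mulrV : right_inverse pres_one pres_inv pres_mul.
Proof.
move=> g; rewrite -{1}(pres_reprK g) /pres_inv pres_mulE.
exact/pres_classP/word_inv_cancel.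
Qed.

HB.instance Definition _ := isGroup.Build presented
  pres_mulA pres_mul1 pres_mulr1 pres_mulV pres_mulrV.

End PresentedGroup.

(* The generators: inl i is sigma_(i+1) and inr i is rho_(i+1), 0 <= i < n-1. *)
Definition gvb_letter (n : nat) : choiceType := ('I_n.-1 + 'I_n.-1)%type.

Definition sg (n : nat) (i : 'I_n.-1) : gvb_letter n * bool := (inl i, false).
Definition rh (n : nat) (i : 'I_n.-1) : gvb_letter n * bool := (inr i, false).

(* |i - j| > 1 *)
Definition far (m : nat) (i j : 'I_m) : bool := (i.+1 < j) || (j.+1 < i).

Inductive gvb_rel (n : nat) :
    word (gvb_letter n) -> word (gvb_letter n) -> Prop :=
| gvb_sigma_comm (i j : 'I_n.-1) : far i j ->
    gvb_rel [:: sg i; sg j] [:: sg j; sg i]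
| gvb_sigma_braid (i j : 'I_n.-1) : j = i.+1 :> nat ->
    gvb_rel [:: sg i; sg j; sg i] [:: sg j; sg i; sg j]
| gvb_rho_comm (i j : 'I_n.-1) : far i j ->
    gvb_rel [:: rh i; rh j] [:: rh j; rh i]
| gvb_rho_braid (i j : 'I_n.-1) : j = i.+1 :> nat ->
    gvb_rel [:: rh i; rh j; rh i] [:: rh j; rh i; rh j]
| gvb_mixed_down (i j : 'I_n.-1) : j = i.+1 :> nat ->
    gvb_rel [:: rh i; sg j; sg i] [:: sg j; sg i; rh j]
| gvb_mixed_up (i j : 'I_n.-1) : j = i.+1 :> nat ->
    gvb_rel [:: rh j; sg i; sg j] [:: sg i; sg j; rh i]
| gvb_mixed_comm (i j : 'I_n.-1) : far i j ->
    gvb_rel [:: sg i; rh j] [:: rh j; sg i].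

Definition GVB (n : nat) : groupType := presented (@gvb_rel n).

Section Subgroups.
Context (G : groupType).
Implicit Types A H : set G.

Definition is_subgroup H : Prop := group_closed [in H].

Definition generated A : set G := smallest is_subgroup A.

Definition derived H : set G :=
  generated [set [~ x, y] | x in H & y in H].

Definition finitely_generated H : Prop :=
  exists2 A, finite_set A & generated A = H.

Definition is_rank H (r : nat) : Prop :=
  (exists2 A, A #= `I_r & generated A = H) /\
  (forall A s, A #= `I_s -> generated A = H -> (r <= s)%N).

Definition perfect H : Prop := H = derived H.

End Subgroups.

(* Main.v *)
(* Conjugation by sigma_1 and by a rho_k that commutes with it generate G modulo
   G'.  The subgroup M generated by the elements rho_i / rho_k, their conjugates by
   powers of rho_k, the sigma_i / sigma_1, and all the conjugates of these by powers
   of sigma_1 is invariant under both conjugations (the mixed relation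
   rho_2 sigma_3 sigma_2 = sigma_3 sigma_2 rho_3 is what makes sigma_2 / sigma_1
   behave), so that M = G' as soon as n >= 4.  The relation
   rho_{i+1} = (sigma_{i+1} sigma_i)^-1 rho_i (sigma_{i+1} sigma_i) then bounds the
   number of conjugates that are needed: for n >= 5, far away generators absorb all
   of them but one, which leaves 2n - 2 <= 3n - 7 generators; for n = 4 all the rho_i
   are conjugate under the group generated by the sigma_i / sigma_1, which is finitely
   generated.  The negative results come from homomorphisms to affine groups of a
   line: the 3-coloring of the trefoil over F_3 (n <= 4) kills G'' but not G', and for
   n = 3 the action of sigma_i by x |-> 1 - x and of rho_i by x |-> 2 x on the
   rationals maps G' to translations of unbounded denominators. *)
From HB Require Import structures.
Require Import Defs.
From mathcomp Require Import all_boot all_order all_algebra.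
From mathcomp Require Import zify ring.
From mathcomp Require Import boolp classical_sets cardinality.

Set Implicit Arguments.
Unset Strict Implicit.
Unset Printing Implicit Defensive.

Import Order.TTheory GRing.Theory Num.Theory.

Local Open Scope classical_set_scope.
Local Open Scope group_scope.

Ltac gsimp :=
  rewrite ?commgEl ?conjgE ?invgM ?invgK ?mulgA
          ?(mulgK, mulgVK, mulVg, mulgV, mul1g, mulg1).

(** * Subgroups, commutators and closure under conjugation *)

Section Subgroups.
Context (G : groupType).
Implicit Types (A H : set G) (x y z g : G).

Lemma is_subgroupP H : is_subgroup H <->
  [/\ H 1, forall x y, H x -> H y -> H (x * y) & forall x, H x -> H x^-1].
Proof.
split=> [Hgrp|[H1 HM HV]].
  have H1 := Hgrp.1; have HM := group_closedM Hgrp.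
  have HV := group_closedV Hgrp; rewrite in_setE in H1.
  split=> // [x y /mem_set Hx /mem_set Hy|x /mem_set Hx]; apply: set_mem.
  - exact: HM.
  - exact: HV.
split; first exact: mem_set.
by move=> x y /set_mem Hx /set_mem Hy; apply/mem_set/HM/HV.
Qed.

Lemma sub1 H : is_subgroup H -> H 1.
Proof. by case/is_subgroupP. Qed.

Lemma subM H x y : is_subgroup H -> H x -> H y -> H (x * y).
Proof. by case/is_subgroupP=> _ HM _; apply: HM. Qed.

Lemma subV H x : is_subgroup H -> H x -> H x^-1.
Proof. by case/is_subgroupP=> _ _; apply. Qed.

Lemma subMl H x y : is_subgroup H -> H x -> H (x * y) -> H y.
Proof.
by move=> Hgrp Hx Hxy; rewrite -(mulKg x y); apply: subM => //; apply: subV.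
Qed.

Lemma subJ H x y : is_subgroup H -> H x -> H y -> H (x ^ y).
Proof.
by move=> Hgrp Hx Hy; rewrite conjgE; do ?apply: subM => //; apply: subV.
Qed.

Lemma generated_subgroup A : is_subgroup (generated A).
Proof.
apply/is_subgroupP; split=> [H [/sub1]|x y Ax Ay H HA|x Ax H HA] //.
  by apply: (subM HA.1); [exact: Ax | exact: Ay].
by apply: (subV HA.1); exact: Ax.
Qed.

Lemma mem_generated A x : A x -> generated A x.
Proof. exact: sub_gen_smallest. Qed.

Lemma generated_sub A H : is_subgroup H -> A `<=` H -> generated A `<=` H.
Proof. exact: smallest_sub. Qed.

Lemma generated_ext A B :
  A `<=` generated B -> B `<=` generated A -> generated A = generated B.
Proof.
by move=> AB BA; apply/seteqP; split; apply: generated_sub => //;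
  exact: generated_subgroup.
Qed.

Lemma derived_subgroup H : is_subgroup (derived H).
Proof. exact: generated_subgroup. Qed.

Lemma mem_derived H x y : H x -> H y -> derived H [~ x, y].
Proof. by move=> Hx Hy; apply: mem_generated; exists x => //; exists y. Qed.

Lemma derived_sub H : is_subgroup H -> derived H `<=` H.
Proof.
move=> Hgrp; apply: generated_sub => // _ [x Hx] [y Hy <-].
by rewrite commgEl; apply: subM; [|apply: subV|apply: subJ].
Qed.

Definition conj_stable g H := forall x, H x -> H (x ^ g).

Lemma preim_conj_subgroup g H :
  is_subgroup H -> is_subgroup [set x | H (x ^ g)].
Proof.
move=> Hgrp; apply/is_subgroupP; split=> /= [|x y Hx Hy|x Hx].
- by rewrite conj1g; apply: sub1.
- by rewrite conjMg; apply: subM.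
- by rewrite conjVg; apply: subV.
Qed.

Lemma generated_conj g A H :
  is_subgroup H -> (forall x, A x -> H (x ^ g)) ->
  forall x, generated A x -> H (x ^ g).
Proof.
move=> Hgrp AH; apply: (@generated_sub A [set x | H (x ^ g)]) => //.
exact: preim_conj_subgroup.
Qed.

Lemma derived_conj_stable g H : conj_stable g H -> conj_stable g (derived H).
Proof.
move=> Hg; apply: generated_conj; first exact: derived_subgroup.
by move=> _ [x Hx] [y Hy <-]; rewrite conjRg; apply: mem_derived; apply: Hg.
Qed.

(* If [d] fixes [x] and [d = g] modulo [H], then [x ^ g] is an [H]-conjugate
   of [x]. *)
Lemma conj_shift H x d g :
  is_subgroup H -> H x -> commute x d -> H (d^-1 * g) -> H (x ^ g).
Proof.
move=> Hgrp Hx xd Hdg; have <-: x ^ (d * (d^-1 * g)) = x ^ g by rewrite mulVKg.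
by rewrite conjgM [x ^ d]conjgE xd mulKg; apply: subJ.
Qed.

(** Modulo [N] the generators commute, so the quotient is abelian. The quotient is avoided: for
    fixed [x] the [y] with [N [~ x, y]] form a subgroup, so generators are replaced by arbitrary
    elements in one argument at a time. *)
Lemma derived_sub_normal A N :
  generated A = [set: G] -> is_subgroup N -> (forall g, conj_stable g N) ->
  (forall x y, A x -> A y -> N [~ x, y]) -> derived [set: G] `<=` N.
Proof.
move=> genA Ngrp Nnorm NA.
have subN x : is_subgroup [set y | N [~ x, y]].
  apply/is_subgroupP; split=> /= [|y z Ny Nz|y Ny].
  - by rewrite commg1; apply: sub1.
  - suff ->: [~ x, y * z] = [~ x, z] * [~ x, y] ^ z.
      by apply: subM => //; exact: Nnorm.
    by gsimp.
  - suff ->: [~ x, y^-1] = ([~ x, y]^-1) ^ y^-1.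
      by apply: (Nnorm); exact: subV.
    by gsimp.
have NC x y : N [~ x, y] -> N [~ y, x] by move=> /(subV Ngrp); rewrite invgR.
have NAT x y : A x -> N [~ x, y].
  move=> Ax; suff: generated A y.
    by move: y; apply: (@generated_sub A [set y | N [~ x, y]]) => // z; apply: NA.
  by rewrite genA.
apply: generated_sub => // _ [x _] [y _ <-].
suff: generated A x.
  move: x; apply: (@generated_sub A [set x | N [~ x, y]]).
    rewrite (_ : mkset _ = [set x | N [~ y, x]]) //.
    by apply/seteqP; split=> z /=; apply: NC.
  by move=> x Ax; apply: NAT.
by rewrite genA.
Qed.

(** Stability under [g^-1] is imposed separately because conjugation by [g] may map a subgroup onto
    a proper part of itself. *)
Definition conj_closure g A : set G :=
  smallest (fun H => [/\ is_subgroup H, conj_stable g H & conj_stable g^-1 H]) A.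

Lemma conj_closure_subgroup g A : is_subgroup (conj_closure g A).
Proof.
apply/is_subgroupP; split=> [H [[Hgrp _ _] _]|x y Ax Ay H HA|x Ax H HA].
- exact: sub1.
- by case: (HA) => -[Hgrp _ _] _; apply: (subM Hgrp); [exact: Ax|exact: Ay].
- by case: (HA) => -[Hgrp _ _] _; apply: (subV Hgrp); exact: Ax.
Qed.

Lemma conj_closure_stable g A : conj_stable g (conj_closure g A).
Proof. by move=> x Ax H HA; case: (HA) => -[_ Hg _] _; exact: (Hg _ (Ax _ HA)). Qed.

Lemma conj_closure_stableV g A : conj_stable g^-1 (conj_closure g A).
Proof. by move=> x Ax H HA; case: (HA) => -[_ _ Hg] _; exact: (Hg _ (Ax _ HA)). Qed.

Lemma conj_closure_sub g A H :
  is_subgroup H -> conj_stable g H -> conj_stable g^-1 H -> A `<=` H ->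
  conj_closure g A `<=` H.
Proof. by move=> Hgrp Hg HgV; apply: smallest_sub. Qed.

Lemma mem_conj_closure g A x : A x -> conj_closure g A x.
Proof. exact: sub_gen_smallest. Qed.

(** As [h] commutes with [g], the elements whose [h]-conjugate lies in the closure again form a
    subgroup stable under [g] and [g^-1]; it is enough that it contains [A]. *)
Lemma conj_closure_conj g h A :
  commute g h -> (forall x, A x -> conj_closure g A (x ^ h)) ->
  conj_stable h (conj_closure g A).
Proof.
move=> gh AH; have Mgrp := @conj_closure_subgroup g A.
apply: (@conj_closure_sub g A [set x | conj_closure g A (x ^ h)]) => //.
- exact: preim_conj_subgroup.
- move=> x /= Hx; rewrite -conjgM gh conjgM; exact: conj_closure_stable.
- move=> x /= Hx; rewrite -conjgM.
  have /commute_sym -> := commuteV (commute_sym gh).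
  by rewrite conjgM; apply: conj_closure_stableV.
Qed.

Lemma finitely_generated_rank (s : seq G) (H : set G) :
  generated [set` s] = H -> exists2 r, is_rank H r & (r <= size s)%N.
Proof.
move=> gens.
pose P k := `[< exists2 A : set G, (A #= `I_k)%card & generated A = H >].
have [c sc cs] : exists2 c, ([set` s] #= `I_c)%card & (c <= size s)%N.
  have les : ([set` s] #<= `I_(size s))%card.
    apply: card_le_trans (card_image_le (nth 1 s) _); apply: subset_card_le.
    by move=> x /= xs; exists (index x s); rewrite /= ?index_mem ?nth_index.
  have /finite_setP[c sc] : finite_set [set` s].
    exact: card_le_finite les (finite_II _).
  exists c => //; move: les; rewrite -card_le_II; apply: card_le_trans.
  by move: sc; rewrite card_eq_le => /andP[].
have exP : exists k, P k by exists c; apply/asboolP; exists [set` s].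
exists (ex_minn exP); case: ex_minnP => r /asboolP Pr rmin.
  by split=> // A k Ak genA; apply: rmin; apply/asboolP; exists A.
by apply: leq_trans cs; apply: rmin; apply/asboolP; exists [set` s].
Qed.

End Subgroups.

(** * Universal property of a presented group *)

Section Presented.
Context (X : choiceType) (R : word X -> word X -> Prop).

Definition letter (x : X) : presented R := pres_class R [:: (x, false)].

Lemma pres_class_cat u v : pres_class R (u ++ v) = pres_class R u * pres_class R v.
Proof. by rewrite [RHS]pres_mulE. Qed.

Lemma pres_class_letter (a : X * bool) :
  pres_class R [:: a] = if a.2 then (letter a.1)^-1 else letter a.1.
Proof.
case: a => x [] //=; apply: (mulgI (letter x)); rewrite mulgV -pres_class_cat.
exact/pres_classP/(word_eq_cancel R (x, false)).
Qed.

Lemma generated_letter : generated (range letter) = [set: presented R].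
Proof.
apply/seteqP; split=> // g _; rewrite -(pres_reprK g).
have Hgrp := generated_subgroup (range letter).
elim: (repr g) => [|a w IHw]; first exact: sub1 Hgrp.
rewrite -cat1s pres_class_cat pres_class_letter; apply: (subM Hgrp) => //.
have La : generated (range letter) (letter a.1) by apply: mem_generated; exists a.1.
by case: ifP => // _; exact: (subV Hgrp).
Qed.

Section Lift.
Context (H : groupType) (f : X -> H).

Definition word_eval (w : word X) : H :=
  \prod_(a <- w) (if a.2 then (f a.1)^-1 else f a.1).

Hypothesis fR : forall u v, R u v -> word_eval u = word_eval v.

Lemma word_eval_eq u v : word_eq R u v -> word_eval u = word_eval v.
Proof.
elim=> {u v} [||u v w _ -> //|u u' v v' _ Eu _ Ev|[x b]|].
- by [].
- by [].
- by rewrite /word_eval !big_cat /= -!/(word_eval _) Eu Ev.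
- by rewrite /word_eval !big_cons big_nil mulg1 /=; case: b; rewrite ?mulgV ?mulVg.
- exact: fR.
Qed.

(** The homomorphism induced by [f]; by [word_eval_eq] the value does not depend on the
    representative chosen by [repr]. *)
Definition pres_lift (g : presented R) : H := word_eval (repr g).

Lemma pres_lift_class w : pres_lift (pres_class R w) = word_eval w.
Proof. exact/word_eval_eq/repr_pres_class. Qed.

Lemma pres_lift_letter x : pres_lift (letter x) = f x.
Proof. by rewrite pres_lift_class /word_eval big_seq1. Qed.

Lemma pres_liftM g h : pres_lift (g * h) = pres_lift g * pres_lift h.
Proof. by rewrite pres_lift_class /word_eval big_cat. Qed.

End Lift.
End Presented.

(** * The defining relations as identities in the group *)

Section Relations.
Context (n : nat).

(* [sigma i] and [rho i] are the paper's sigma_(i+1) and rho_(i+1), and [1] when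
   [i >= n - 1]. *)
Definition sigma (i : nat) : GVB n :=
  if insub i is Some k then letter (@gvb_rel n) (inl k) else 1.
Definition rho (i : nat) : GVB n :=
  if insub i is Some k then letter (@gvb_rel n) (inr k) else 1.

Lemma sigma_ord (i : 'I_n.-1) : sigma i = letter (@gvb_rel n) (inl i).
Proof. by rewrite /sigma valK. Qed.

Lemma rho_ord (i : 'I_n.-1) : rho i = letter (@gvb_rel n) (inr i).
Proof. by rewrite /rho valK. Qed.

Lemma generated_sigma_rho :
  generated [set g | exists2 i, i < n.-1 & g = sigma i \/ g = rho i] =
  [set: GVB n].
Proof.
rewrite -generated_letter; apply: generated_ext => g.
  case=> i lti gi; apply: mem_generated; move: gi.
  by rewrite -[i]/(val (Ordinal lti)) sigma_ord rho_ord; case=> ->.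
case=> -[] i _ <-; apply: mem_generated; exists i => //.
  by left; rewrite sigma_ord.
by right; rewrite rho_ord.
Qed.

Lemma letter_rel u v :
  gvb_rel u v -> pres_class (@gvb_rel n) u = pres_class (@gvb_rel n) v.
Proof. by move=> uv; apply/pres_classP/word_eq_rel. Qed.

Let pres_class2 a b : pres_class (@gvb_rel n) [:: (a, false); (b, false)] =
  letter _ a * letter _ b.
Proof. by rewrite -pres_class_cat. Qed.

Let pres_class3 a b c :
  pres_class (@gvb_rel n) [:: (a, false); (b, false); (c, false)] =
  letter _ a * letter _ b * letter _ c.
Proof. by rewrite -mulgA -pres_class2 -cat1s pres_class_cat. Qed.

Let farP i j : i < n.-1 -> j < n.-1 -> (i.+1 < j) || (j.+1 < i) ->
  exists i' j' : 'I_n.-1, [/\ i = i', j = j' & far i' j'].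
Proof. by move=> lti ltj fij; exists (Ordinal lti), (Ordinal ltj); split. Qed.

Let nextP i : i.+1 < n.-1 -> 
  exists i' j' : 'I_n.-1, [/\ i = i', i.+1 = j' & j' = i'.+1 :> nat].
Proof. by move=> lti; exists (Ordinal (ltnW lti)), (Ordinal lti); split. Qed.

Lemma sigmaC i j : i < n.-1 -> j < n.-1 -> (i.+1 < j) || (j.+1 < i) ->
  commute (sigma i) (sigma j).
Proof.
move=> lti ltj fij; have [i' [j' [-> -> fij']]] := farP lti ltj fij.
by rewrite !sigma_ord /commute -!pres_class2; apply/letter_rel/gvb_sigma_comm.
Qed.

Lemma rhoC i j : i < n.-1 -> j < n.-1 -> (i.+1 < j) || (j.+1 < i) ->
  commute (rho i) (rho j).
Proof.
move=> lti ltj fij; have [i' [j' [-> -> fij']]] := farP lti ltj fij.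
by rewrite !rho_ord /commute -!pres_class2; apply/letter_rel/gvb_rho_comm.
Qed.

Lemma sigma_rhoC i j : i < n.-1 -> j < n.-1 -> (i.+1 < j) || (j.+1 < i) ->
  commute (sigma i) (rho j).
Proof.
move=> lti ltj fij; have [i' [j' [-> -> fij']]] := farP lti ltj fij.
rewrite !sigma_ord !rho_ord /commute -!pres_class2.
exact/letter_rel/gvb_mixed_comm.
Qed.

Lemma sigma_braid i : i.+1 < n.-1 ->
  sigma i * sigma i.+1 * sigma i = sigma i.+1 * sigma i * sigma i.+1.
Proof.
move=> /nextP[i' [j' [Ei Ej ij]]]; rewrite Ej Ei.
by rewrite !sigma_ord -!pres_class3; apply/letter_rel/gvb_sigma_braid.
Qed.

Lemma rho_braid i : i.+1 < n.-1 ->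
  rho i * rho i.+1 * rho i = rho i.+1 * rho i * rho i.+1.
Proof.
move=> /nextP[i' [j' [Ei Ej ij]]]; rewrite Ej Ei.
by rewrite !rho_ord -!pres_class3; apply/letter_rel/gvb_rho_braid.
Qed.

(** The mixed relations, read as conjugations: neighbouring [rho]s are conjugate under words in the
    [sigma]s. *)
Lemma rho_conj_down i : i.+1 < n.-1 ->
  rho i ^ (sigma i.+1 * sigma i) = rho i.+1.
Proof.
move=> /nextP[i' [j' [Ei Ej ij]]]; rewrite Ej Ei.
apply: (mulgI (sigma j' * sigma i')); rewrite -conjgC mulgA.
rewrite !sigma_ord !rho_ord -!pres_class3.
exact/letter_rel/gvb_mixed_down.
Qed.

Lemma rho_conj_up i : i.+1 < n.-1 ->
  rho i.+1 ^ (sigma i * sigma i.+1) = rho i.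
Proof.
move=> /nextP[i' [j' [Ei Ej ij]]]; rewrite Ej Ei.
apply: (mulgI (sigma i' * sigma j')); rewrite -conjgC mulgA.
rewrite !sigma_ord !rho_ord -!pres_class3.
exact/letter_rel/gvb_mixed_up.
Qed.

End Relations.

(** * Normal subgroups and congruences modulo them *)

Section NormalSubgroups.
Context (G : groupType).
Implicit Types (H N : set G) (x y g : G).

Lemma divg_sub H x y z : is_subgroup H -> H (x / z) -> H (y / z) -> H (x / y).
Proof.
move=> Hgrp Hx Hy; have ->: x / y = (x / z) / (y / z) by gsimp.
by apply: (subM Hgrp) => //; apply: (subV Hgrp).
Qed.

(** The [g] such that both [g] and [g^-1] stabilize [N] form a subgroup, so testing generators
    suffices. *)
Lemma generated_conj_stable A N :
  generated A = [set: G] -> is_subgroup N ->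
  (forall x, A x -> conj_stable x N) -> (forall x, A x -> conj_stable x^-1 N) ->
  forall g, conj_stable g N.
Proof.
move=> genA Ngrp NA NAV g.
suff /(_ g)[] : [set: G] `<=` [set g | conj_stable g N /\ conj_stable g^-1 N] by [].
rewrite -genA; apply: generated_sub => [|x Ax]; last by split; [exact: NA|exact: NAV].
apply/is_subgroupP; split=> [|x y [Nx NxV] [Ny NyV]|x [Nx NxV]].
- by split=> z; rewrite ?invg1 conjg1.
- by split=> z Nz; rewrite ?invgM conjgM; [apply/Ny/Nx|apply/NxV/NyV].
- by split; rewrite ?invgK.
Qed.

(** Modulo [N] the two entries are [c] and [d], which commute. *)
Lemma commg_normal N s t c d :
  is_subgroup N -> (forall g, conj_stable g N) ->
  N s -> N t -> commute c d -> N [~ s * c, t * d].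
Proof.
move=> Ngrp Nnorm Ns Nt cd.
have ->: [~ s * c, t * d] = [~ s, t * d] ^ c * ([~ c, d] * [~ c, t] ^ d) by gsimp.
have /commgP/eqP -> := cd; rewrite mul1g; apply: (subM Ngrp); apply: (Nnorm).
  by rewrite commgEl; apply: (subM Ngrp); [apply: (subV Ngrp)|apply: (Nnorm)].
by rewrite commgEr; apply: (subM Ngrp) => //; apply/Nnorm/(subV Ngrp).
Qed.


(** * Sequences satisfying the braid relations *)

Section BraidChain.
Context (m : nat) (f : nat -> G).
Hypothesis braid : forall i, i.+1 < m ->
  f i * f i.+1 * f i = f i.+1 * f i * f i.+1.
Hypothesis comm : forall i j, i < m -> j < m -> (i.+1 < j) || (j.+1 < i) ->
  commute (f i) (f j).

(** Turns commuting into equality: neighbours agree modulo a subgroup exactly when their commutator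
    lies in it. *)
Lemma braid_commg i : i.+1 < m -> [~ f i, f i.+1] = f i.+1 / f i.
Proof.
move=> lti; apply: (mulIg (f i)); rewrite mulgVK.
apply: (mulgI (f i.+1 * f i)); rewrite -braid //; gsimp.
by rewrite braid //; gsimp.
Qed.

Lemma divg_telescope N : is_subgroup N ->
  (forall i, i.+1 < m -> N (f i.+1 / f i)) ->
  forall i j, i < m -> j < m -> N (f i / f j).
Proof.
move=> Ngrp Nf.
have N0 i : i < m -> N (f i / f 0).
  elim: i => [_|i IHi lti]; first by rewrite mulgV; apply: (sub1 Ngrp).
  rewrite -(divgKA (f i)); apply: (subM Ngrp); [exact: Nf|exact/IHi/ltnW].
by move=> i j lti ltj; apply: (divg_sub Ngrp); apply: N0.
Qed.

Lemma braid_divg_derived i j : i < m -> j < m -> derived [set: G] (f i / f j).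
Proof.
apply: divg_telescope => {i j} [|i lti]; first exact: derived_subgroup.
by rewrite -braid_commg //; apply: mem_derived.
Qed.

(* Modulo the second derived subgroup, [f 1 / f 0] commutes with [f 3] and with
   [f 0 / f 3], hence with [f 0]; so [f 0] and [f 1] commute, and the braid
   relations propagate [f 0 = f 1] to all the [f i]. *)
Lemma braid_divg_derived2 i j : 3 < m -> i < m -> j < m ->
  derived (derived [set: G]) (f i / f j).
Proof.
set N := derived _ => m4; have Ngrp : is_subgroup N by exact: derived_subgroup.
have Nnorm g : conj_stable g N by do 2![apply: derived_conj_stable].
apply: divg_telescope => {i j} //; elim=> [|i IHi] lti; last first.
  (* Modulo [N], [f i.+1] may be replaced by [f i], which commutes with [f i.+2]. *)
  rewrite -braid_commg // -(mulgVK (f i) (f i.+1)) -[f i.+2]mul1g.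
  apply: commg_normal => //; [|exact: sub1|].
    by apply: IHi; apply: ltnW.
  by apply: comm; rewrite ?leqnn //; apply: ltn_trans lti.
have c03 : commute (f 0) (f 3) by apply: comm; rewrite // (ltn_trans _ m4).
have c13 : commute (f 1) (f 3) by apply: comm; rewrite // (ltn_trans _ m4).
have cs3 : commute (f 1 / f 0) (f 3).
  by apply/commute_sym/commuteM; [|apply: commuteV]; apply: commute_sym.
have Ns : N [~ f 1 / f 0, f 0].
  have ->: [~ f 1 / f 0, f 0] = [~ f 1 / f 0, f 0 / f 3].
    have -> : f 0 / f 3 = (f 3)^-1 * f 0 by apply/commuteV.
    have /commuteV/commgP/eqP cs : commute (f 1 / f 0) (f 3) by [].
    suff ->: [~ f 1 / f 0, (f 3)^-1 * f 0] =
        [~ f 1 / f 0, f 0] * [~ f 1 / f 0, (f 3)^-1] ^ f 0.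
      by rewrite cs conj1g mulg1.
    by gsimp.
  by apply: mem_derived; apply: braid_divg_derived => //; apply: leq_trans m4.
rewrite -braid_commg // -invgR; apply: (subV Ngrp).
have ->: [~ f 1, f 0] = [~ f 1 / f 0, f 0] ^ f 0 by gsimp.
exact: Nnorm.
Qed.

End BraidChain.
End NormalSubgroups.

Lemma commute_conj (G : groupType) (x y : G) : commute x y -> x ^ y = x.
Proof. by move=> xy; rewrite conjgE xy mulKg. Qed.

(* The first terms of the sequence [s_k = s ^ (x ^ k)], where [s = y / x], satisfy
   [s_(-1) = s_0 * s_(-2)]: two consecutive ones generate all of them. *)
Lemma braid_conj_stable (G : groupType) (H : set G) (x y : G) :
  is_subgroup H -> x * y * x = y * x * y -> H (y / x) -> H ((y / x) ^ x^-1) ->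
  H ((y / x) ^ x) /\ H (((y / x) ^ x^-1) ^ x^-1).
Proof.
move=> Hgrp xy Hs Hs1.
have rec : (y / x) ^ x^-1 = (y / x) * (((y / x) ^ x^-1) ^ x^-1).
  apply: (mulIg (x * x * x)); gsimp; exact: xy.
move: (y / x) Hs Hs1 rec => s Hs Hs1 rec; split.
  have: (s ^ x^-1) ^ x = (s * (s ^ x^-1) ^ x^-1) ^ x by rewrite -rec.
  rewrite conjMg !conjgKV => /esym/(canRL (mulgK _)) ->.
  by apply: (subM Hgrp) => //; apply: (subV Hgrp).
by apply: (subMl Hgrp Hs); rewrite -rec.
Qed.

(** * Criteria for a subgroup to contain the derived subgroup *)

Section Generation.
Context (n : nat).
Local Notation sigma := (@sigma n).
Local Notation rho := (@rho n).
Implicit Types (H N B : set (GVB n)).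

(** Modulo [N] each [sigma i] is [a] and each [rho i] is [b], and these commute. Normality of [N]
    need only be tested on [a] and [b], since elements of [N] normalize it. *)
Lemma derived_sub_quotient (a b : GVB n) N :
  is_subgroup N -> conj_stable a N -> conj_stable a^-1 N ->
  conj_stable b N -> conj_stable b^-1 N -> commute a b ->
  (forall i, i < n.-1 -> N (sigma i / a)) ->
  (forall i, i < n.-1 -> N (rho i / b)) -> derived [set: GVB n] `<=` N.
Proof.
move=> Ngrp Na NaV Nb NbV ab Ns Nr.
have gen := generated_sigma_rho n.
have stab c g : conj_stable c N -> conj_stable c^-1 N -> N (g / c) ->
    conj_stable g N /\ conj_stable g^-1 N.
  move=> Nc NcV Ngc; rewrite -{1 2}(mulgVK c g); split=> x Nx.
    by rewrite conjgM; apply/Nc/(subJ Ngrp).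
  by rewrite invgM conjgM; apply: (subJ Ngrp); [apply: NcV|apply: (subV Ngrp)].
have Nnorm g : conj_stable g N.
  apply: (generated_conj_stable gen) => // _ [i lti [] ->].
  - by have [] := stab _ _ Na NaV (Ns i lti).
  - by have [] := stab _ _ Nb NbV (Nr i lti).
  - by have [] := stab _ _ Na NaV (Ns i lti).
  - by have [] := stab _ _ Nb NbV (Nr i lti).
have norm x : (exists2 i, i < n.-1 & x = sigma i \/ x = rho i) ->
    exists2 c, c = a \/ c = b & N (x / c).
  by case=> i lti [] ->; [exists a|exists b]; auto.
apply: (derived_sub_normal gen) => // x y /norm[c ac Nx] /norm[d ad Ny].
rewrite -(mulgVK c x) -(mulgVK d y); apply: commg_normal => //.
by case: ac => ->; case: ad => ->; rewrite /commute.
Qed.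

(* The smallest [sigma 0]-stable subgroup [M] containing [B] and the
   [sigma i / sigma 0] is also [rho k]-stable. *)
Lemma derived_sub_stable k H B : 2 <= k -> k < n.-1 ->
  is_subgroup H -> conj_stable (sigma 0) H -> conj_stable (sigma 0)^-1 H ->
  (forall i, i < n.-1 -> H (sigma i / sigma 0)) ->
  is_subgroup B -> B `<=` H ->
  conj_stable (rho k) B -> conj_stable (rho k)^-1 B ->
  (forall i, i < n.-1 -> B (rho i / rho k)) -> derived [set: GVB n] `<=` H.
Proof.
move=> k2 ltk Hgrp Ha HaV Hs Bgrp BH Bb BbV Br.
set a := sigma 0 in Ha HaV Hs *; set b := rho k in Bb BbV Br *.
have n4 : 2 < n.-1 by apply: leq_ltn_trans ltk.
have ab : commute a b by apply: sigma_rhoC; rewrite ?k2 // (ltn_trans _ n4).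
pose X := B `|` [set g | exists2 i, i < n.-1 & g = sigma i / a].
pose M := conj_closure a X.
have Mgrp : is_subgroup M by exact: conj_closure_subgroup.
have Ma : conj_stable a M by exact: conj_closure_stable.
have MaV : conj_stable a^-1 M by exact: conj_closure_stableV.
have BM x : B x -> M x by move=> Bx; apply: mem_conj_closure; left.
have Ms i : i < n.-1 -> M (sigma i / a).
  by move=> lti; apply: mem_conj_closure; right; exists i.
have Mstable h : commute a h -> (forall x, X x -> M (x ^ h)) -> conj_stable h M.
  exact: conj_closure_conj.
have MH : M `<=` H.
  by apply: conj_closure_sub => // x [/BH //|[i lti ->]]; apply: Hs.
clearbody M.
(* Treats [c = b] and [c = b^-1] together: [c] acts on [sigma i], [i >= 2], like an element [z] of
   [B], and multiplies [sigma 2 * sigma 1] by factors from [B]. Such factors stay in [M] after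
   conjugation by powers of [a]. *)
have key c z z1 z2 : commute a c -> conj_stable c B -> B z -> B z1 -> B z2 ->
    (forall i, 2 <= i < n.-1 -> sigma i ^ c = sigma i ^ z) ->
    (sigma 2 * sigma 1) ^ c = z1 * (sigma 2 * sigma 1) * z2 -> conj_stable c M.
  move=> ac Bc Bz Bz1 Bz2 sc s21c; have aVc : a^-1 ^ c = a^-1.
    by rewrite conjVg commute_conj.
  have Mc i : 2 <= i < n.-1 -> M ((sigma i / a) ^ c).
    move=> /andP[i2 lti]; rewrite conjMg aVc sc ?i2 //.
    have ->: sigma i ^ z / a = z^-1 * (sigma i / a) * z ^ a^-1 by gsimp.
    apply: (subM Mgrp); last exact/MaV/BM.
    by apply: (subM Mgrp); [exact/BM/(subV Bgrp)|exact: Ms].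
  apply: Mstable => // x [/Bc/BM //|[[|[|i]] lti ->]].
  - by rewrite mulgV conj1g; apply: (sub1 Mgrp).
  (* Commutation with [rho 0] starts only at [sigma 2], so [sigma 1] is recovered from [sigma 2] and
     from the product [sigma 2 * sigma 1], whose conjugate the mixed relation controls. *)
  - pose v := sigma 2 * sigma 1 / a / a.
    have vE : v = (sigma 2 / a) * (sigma 1 / a) ^ a^-1 by rewrite /v; gsimp.
    have ->: sigma 1 / a = ((sigma 2 / a)^-1 * v) ^ a by rewrite vE; gsimp.
    rewrite -conjgM ac conjgM; apply: Ma; rewrite conjMg conjVg.
    apply: (subM Mgrp); first by apply/(subV Mgrp)/Mc; rewrite n4.
    have ->: v ^ c = z1 * v * (z2 ^ a^-1) ^ a^-1.
      by rewrite /v conjMg aVc conjMg aVc s21c; gsimp.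
    apply: (subM Mgrp); last exact/MaV/MaV/BM.
    apply: (subM Mgrp); first exact: BM.
    by rewrite vE; apply: (subM Mgrp); [exact: Ms|exact/MaV/Ms/ltnW].
  - exact: Mc.
have rhoE i : rho i = rho i / b * b by rewrite mulgVK.
have n1 := ltnW n4; have n0 := ltnW n1.
have c0 i : 2 <= i < n.-1 -> commute (sigma i) (rho 0).
  by move=> /andP[i2 lti]; apply: sigma_rhoC; rewrite ?i2 ?orbT.
have s21 : rho 1 * (sigma 2 * sigma 1) = sigma 2 * sigma 1 * rho 2.
  by rewrite conjgC (rho_conj_down n4).
have Mb : conj_stable b M.
  (* The witnesses are [(rho 0)^-1 * b], [b^-1 * rho 1] and [(rho 2)^-1 * b]: the first acts on
     [sigma i] as [b] does because [rho 0] fixes [sigma i], the others come from [s21]. *)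
  apply: (key _ ((rho 0 / b) ^ b)^-1 ((rho 1 / b) ^ b) ((rho 2 / b) ^ b)^-1) => //.
  - by apply: (subV Bgrp); apply/Bb/Br.
  - by apply/Bb/Br.
  - by apply: (subV Bgrp); apply/Bb/Br.
  - move=> i /c0 /commute_conj ci.
    by rewrite -{2}ci -conjgM; congr (_ ^ _); gsimp.
  - apply: (mulgI b); apply: (mulIg (b^-1 * rho 2)); gsimp.
    by rewrite -s21 mulgA.
have MbV : conj_stable b^-1 M.
  apply: (key _ (rho 0 / b) (rho 1 / b)^-1 (rho 2 / b)) => //.
  - exact: commuteV.
  - exact: Br.
  - by apply: (subV Bgrp); apply/Br.
  - exact: Br.
  - move=> i /c0 /commute_conj ci.
    by rewrite -{2}(conjgK b (sigma i)) -{1}ci -!conjgM; congr (_ ^ _); gsimp.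
  - apply: (mulgI (rho 1 / b)); apply: (mulIg b); gsimp.
    by rewrite -s21 mulgA.
apply: (subset_trans _ MH); apply: (derived_sub_quotient _ _ _ _ _ ab) => // i lti.
exact/BM/Br.
Qed.

End Generation.

(** * An explicit generating set of the derived subgroup for five or more strands *)

Section FiniteGeneration.
Context (n : nat).
Local Notation sigma := (@sigma n).
Local Notation rho := (@rho n).

Lemma derived_stable g : conj_stable g (derived [set: GVB n]).
Proof. by apply: derived_conj_stable. Qed.

Lemma sigma_divg_derived i j : i < n.-1 -> j < n.-1 ->
  derived [set: GVB n] (sigma i / sigma j).
Proof. by apply: braid_divg_derived => k; apply: sigma_braid. Qed.

Lemma rho_divg_derived i j : i < n.-1 -> j < n.-1 ->
  derived [set: GVB n] (rho i / rho j).
Proof. by apply: braid_divg_derived => k; apply: rho_braid. Qed.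

Definition derived_gens5 : seq (GVB n) :=
  ((rho 1 / rho 3) ^ (sigma 0)^-1) ::
  [seq sigma i.+1 / sigma 0 | i <- iota 0 n.-2] ++
  [seq rho i / rho 3 | i <- iota 0 n.-1].

Lemma generated_derived_gens5 : 5 <= n ->
  generated [set` derived_gens5] = derived [set: GVB n].
Proof.
move=> n5; have n3 : 3 < n.-1 by case: n n5.
have n2 := ltnW n3; have n1 := ltnW n2; have n0 := ltnW n1.
set H := generated _; have Hgrp : is_subgroup H by exact: generated_subgroup.
set a := sigma 0; set b := rho 3.
pose B := generated [set` [seq rho i / b | i <- iota 0 n.-1]].
have Bgrp : is_subgroup B by exact: generated_subgroup.
have Hs i : i < n.-1 -> H (sigma i / a).
  case: i => [_|i lti]; first by rewrite mulgV; apply: (sub1 Hgrp).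
  apply: mem_generated; rewrite /= inE mem_cat.
  by apply/or3P/Or32/mapP; exists i => //; rewrite mem_iota /= add0n ltn_predRL.
have Br i : i < n.-1 -> B (rho i / b).
  by move=> lti; apply: mem_generated; apply/mapP; exists i; rewrite ?mem_iota.
have BH : B `<=` H.
  apply: generated_sub => // x /= xB; apply: mem_generated.
  by rewrite /= inE mem_cat xB !orbT.
have Hr i : i < n.-1 -> H (rho i / b) by move=> /Br/BH.
have Hp : H ((rho 1 / b) ^ a^-1) by apply: mem_generated; rewrite /= inE eqxx.
have cab : commute a b by apply: sigma_rhoC.
have cs03 : commute a (sigma 3) by apply: sigmaC.
have cr03 : commute (rho 0) b by apply: rhoC.
apply/seteqP; split.
  apply: generated_sub; first exact: derived_subgroup.
  move=> x /=; rewrite inE mem_cat => /or3P[/eqP->|/mapP[i]|/mapP[i]].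
  - by apply: derived_stable; apply: rho_divg_derived.
  - rewrite mem_iota => lti ->; apply: sigma_divg_derived => //.
    by rewrite -ltn_predRL.
  - by rewrite mem_iota => lti ->; apply: rho_divg_derived.
have Bstable g : g = b \/ g = b^-1 -> conj_stable g B.
  move=> gb; apply: generated_conj => // _ /mapP[i + ->]; rewrite mem_iota => lti.
  (* For [i < 2], [rho i / b] commutes with [b]. Otherwise it commutes with [rho 0], which agrees
     with [b] modulo [B], so conjugating by [b] amounts to conjugating inside [B]. *)
  have [i2|i2] := ltnP i 2.
    rewrite commute_conj; first exact: Br.
    have: commute (rho i / b) b.
      apply/commute_sym/commuteM; last exact: commuteV.
      by apply: rhoC; rewrite // ltnS i2 orbT.
    by case: gb => ->; last apply: commuteV.
  have c0 : commute (rho i / b) (rho 0).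
    apply/commute_sym/commuteM; first by apply: rhoC; rewrite ?i2.
    exact: commuteV.
  have B0 := Br _ n0.
  case: gb => ->.
    apply: (conj_shift (d := rho 0) Bgrp) => //; first exact: Br.
    have ->: (rho 0)^-1 * b = (rho 0 / b)^-1.
      by rewrite invgF; apply/commute_sym/commuteV/commute_sym.
    exact: (subV Bgrp).
  apply: (conj_shift (d := (rho 0)^-1) Bgrp) => //; [exact: Br|exact: commuteV|].
  by rewrite invgK.
(* [sigma 3] agrees with [a] modulo [H], so on its centralizer conjugation by [a] is conjugation by
   an element of [H]. *)
have shift3 x : H x -> commute x (sigma 3) -> H (x ^ a) /\ H (x ^ a^-1).
  move=> Hx c3; split.
    apply: (conj_shift Hgrp Hx c3).
    have ->: (sigma 3)^-1 * a = (sigma 3 / a)^-1.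
      by rewrite invgF; apply/commute_sym/commuteV.
    by apply: (subV Hgrp); apply: Hs.
  apply: (conj_shift Hgrp Hx (commuteV c3)); rewrite invgK; exact: Hs.
have shift0 x : H x -> commute x a -> H (x ^ a) /\ H (x ^ a^-1).
  by move=> Hx c0; rewrite !commute_conj //; apply: commuteV.
have HaS i : i < n.-1 -> H ((sigma i / a) ^ a) /\ H ((sigma i / a) ^ a^-1).
  move=> lti; have [i2|i2] := ltnP i 2.
    apply: shift3; first exact: Hs.
    apply/commute_sym/commuteM; first by apply: sigmaC; rewrite // ltnS i2 orbT.
    exact/commuteV.
  apply: shift0; first exact: Hs.
  apply/commute_sym/commuteM; first by apply: sigmaC; rewrite ?i2.
  exact: commuteV.
have cbV g : commute g b -> b^-1 ^ g = b^-1.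
  by move=> gb; apply/commute_conj/commute_sym/commuteV.
have cs1b : commute (sigma 1) b by apply: sigma_rhoC.
have r1a : (rho 1 / b) ^ a = ((rho 0 / b) ^ a^-1) ^ (sigma 1 / a)^-1.
  have ->: rho 0 / b = ((rho 1 / b) ^ a) ^ sigma 1.
    by rewrite 2![in RHS]conjMg !cbV // -(rho_conj_up n1) conjgM.
  by gsimp.
have r1aV : ((rho 1 / b) ^ a^-1) ^ a^-1 = (rho 0 / b) ^ (sigma 1 / a).
  have ->: rho 1 / b = ((rho 0 / b) ^ sigma 1) ^ a.
    rewrite [_ ^ sigma 1]conjMg cbV // [in RHS]conjMg cbV //.
    by rewrite -(rho_conj_down n1) conjgM.
  by gsimp.
(* [rho 0 / rho 1] commutes with [sigma 3]. Its conjugates carry the listed [(rho 1 / b) ^ a^-1] to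
   [(rho 0 / b) ^ a^-1], then [r1a] gives [(rho 1 / b) ^ a], and finally [(rho 0 / b) ^ a]
   follows. *)
have [Hqa HqaV] : H ((rho 0 / rho 1) ^ a) /\ H ((rho 0 / rho 1) ^ a^-1).
  apply: shift3; first exact: (divg_sub Hgrp (Hr _ n0) (Hr _ n1)).
  apply/commute_sym/commuteM; first exact: sigma_rhoC.
  exact/commuteV/sigma_rhoC.
have r0E : rho 0 / b = (rho 0 / rho 1) * (rho 1 / b) by rewrite divgKA.
have Hr0aV : H ((rho 0 / b) ^ a^-1) by rewrite r0E conjMg; apply: (subM Hgrp).
have Hr1a : H ((rho 1 / b) ^ a).
  by rewrite r1a; apply: (subJ Hgrp); [exact: Hr0aV|apply: (subV Hgrp); exact: Hs].
have Hr0a : H ((rho 0 / b) ^ a) by rewrite r0E conjMg; apply: (subM Hgrp).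
have HaR i : i < n.-1 -> H ((rho i / b) ^ a) /\ H ((rho i / b) ^ a^-1).
  case: i => [|[|i]] lti //; apply: shift0; first exact: Hr.
  by apply/commute_sym/commuteM; [exact: sigma_rhoC|exact: commuteV].
have Hstable g : g = a \/ g = a^-1 -> conj_stable g H.
  move=> ga; apply: generated_conj => // x /=.
  rewrite inE mem_cat => /or3P[/eqP->|/mapP[i]|/mapP[i]].
  - case: ga => ->; first by rewrite conjgKV; exact: Hr.
    by rewrite r1aV; apply: (subJ Hgrp); [exact: Hr|exact: Hs].
  - rewrite mem_iota add0n ltn_predRL => lti ->.
    by have [? ?] := HaS i.+1 lti; case: ga => ->.
  - rewrite mem_iota => lti ->.
    by have [? ?] := HaR i lti; case: ga => ->.
apply: (@derived_sub_stable n 3 H B) => //;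
  try by [apply: Hstable; auto|apply: Bstable; auto].
Qed.

Lemma size_derived_gens5 : 5 <= n -> size derived_gens5 <= 3 * n - 7.
Proof.
move=> n5; rewrite /= size_cat !size_map !size_iota.
by case: n n5 => [|[|[|[|[|k]]]]] // _; lia.
Qed.
End FiniteGeneration.

(* All [rho i] are conjugate to [rho 0] under the group [A] generated by the
   [sigma i / sigma 0], so [A], its conjugates by [rho 2] and [rho 2 ^+ 2], and
   [rho 0 / rho 2] suffice. *)
Section FourStrands.
Local Notation sigma := (@sigma 4).
Local Notation rho := (@rho 4).

Lemma finitely_generated_derived_GVB4 : finitely_generated (derived [set: GVB 4]).
Proof.
pose a := sigma 0; pose b := rho 2; pose s := sigma 1 / a; pose c := sigma 2 / a.
pose l := [:: s; s ^ a^-1; c].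
pose l' := l ++ [seq x ^ b^-1 | x <- l] ++ [seq (x ^ b^-1) ^ b^-1 | x <- l]
             ++ [:: rho 0 / b].
pose A := generated [set` l]; pose H := generated [set` l'].
have Agrp : is_subgroup A by exact: generated_subgroup.
have Hgrp : is_subgroup H by exact: generated_subgroup.
have cab : commute a b by exact: sigma_rhoC.
have ca2 : commute a (sigma 2) by exact: sigmaC.
have c02 : commute (rho 0) (sigma 2) by exact/commute_sym/sigma_rhoC.
have c0b : commute (rho 0) b by exact: rhoC.
have cac : commute c a by apply/commute_sym/commuteM => //; exact: commuteV.
have cr0b : commute (rho 0 / b) b.
  by apply/commute_sym/commuteM; [exact: commute_sym|exact: commuteV].
have As : A s by apply: mem_generated; rewrite /= !inE eqxx.
have As1 : A (s ^ a^-1) by apply: mem_generated; rewrite /= !inE eqxx orbT.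
have Ac : A c by apply: mem_generated; rewrite /= !inE eqxx !orbT.
have [Asa As2] := braid_conj_stable Agrp (@sigma_braid 4 0 isT) As As1.
have Astable g : g = a \/ g = a^-1 -> conj_stable g A.
  move=> ga; apply: generated_conj => // x /=; rewrite !inE => /or3P[] /eqP ->.
  - by case: ga => ->.
  - by case: ga => ->; rewrite ?conjgKV.
  - by case: ga => ->; rewrite commute_conj //; apply: commuteV.
have memH x : x \in l' -> H x by move=> lx; exact: mem_generated.
have HA0 x : A x -> H x.
  move: x; apply: generated_sub => // x /= lx; apply: memH.
  by rewrite mem_cat lx.
have HA1 x : A x -> H (x ^ b^-1).
  move: x; apply: generated_conj => // x /= lx; apply: memH.
  by rewrite /l' !mem_cat (map_f (fun x => x ^ b^-1) lx) !orbT.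
have HA2 x : A x -> H ((x ^ b^-1) ^ b^-1).
  move=> Ax; rewrite -conjgM; move: x Ax; apply: generated_conj => // x /= lx.
  apply: memH; rewrite conjgM /l' !mem_cat.
  by rewrite (map_f (fun x => (x ^ b^-1) ^ b^-1) lx) !orbT.
have H0 : H (rho 0 / b) by apply: memH; rewrite /l' !mem_cat mem_seq1 eqxx !orbT.
have r0x x : rho 0 ^ x / b = x^-1 * (rho 0 / b) * x ^ b^-1 by gsimp.
have Hr0x x : A x -> H (rho 0 ^ x / b).
  move=> Ax; rewrite r0x; apply: (subM Hgrp); last exact: HA1.
  by apply: (subM Hgrp) => //; apply: (subV Hgrp); apply: HA0.
have bg g : g = a \/ g = a^-1 -> commute g b^-1.
  by case=> ->; apply: commuteV => //; exact/commute_sym/commuteV/commute_sym.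
have Hstable g : g = a \/ g = a^-1 -> conj_stable g H.
  move=> ga; have Ag := Astable g ga; have gb := bg g ga.
  have bJ x : (x ^ b^-1) ^ g = (x ^ g) ^ b^-1 by rewrite -!conjgM gb.
  have lA x : x \in l -> A x by move=> lx; exact: mem_generated.
  apply: generated_conj => // x /=.
  rewrite !mem_cat mem_seq1 => /or4P[lx|/mapP[y ly ->]|/mapP[y ly ->]|/eqP->].
  - exact: (HA0 _ (Ag _ (lA _ lx))).
  - by rewrite bJ; exact: (HA1 _ (Ag _ (lA _ ly))).
  - by rewrite !bJ; exact: (HA2 _ (Ag _ (lA _ ly))).
  - rewrite conjMg [b^-1 ^ g]commute_conj; last exact: commute_sym.
    case: ga => ->.
      (* [a = sigma 2 * c^-1] and [sigma 2] fixes [rho 0], so the conjugation can be done inside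
         [A]. *)
      suff ->: rho 0 ^ a = rho 0 ^ c^-1 by apply: Hr0x; apply: (subV Agrp).
      by rewrite -{2}(commute_conj c02) -conjgM invgF mulgA -ca2 mulgK.
    suff ->: rho 0 ^ a^-1 = rho 0 ^ c by apply: Hr0x.
    by rewrite -{2}(commute_conj (commuteV c02)) -conjgM mulKg.
(* Chosen so that [sigma 2 * sigma 2 * x = sigma 1 * a]: the left factors fix [rho 0], and the right
   side takes it to [rho 1]. *)
pose x := (c^-1 * c^-1) * (s ^ a) ^ a.
have Ax : A x.
  by apply: (subM Agrp); [apply: (subM Agrp); apply: (subV Agrp)|apply: Astable; auto].
have r1E : rho 1 = rho 0 ^ x.
  rewrite -(rho_conj_down (n := 4) (i := 0)) //.
  have r2 : rho 0 ^ (sigma 2 * sigma 2) = rho 0 by rewrite conjgM !commute_conj.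
  rewrite -{2}r2 -conjgM; congr (_ ^ _).
  have c2 : sigma 2 * c^-1 = a by rewrite invgF mulgA -ca2 mulgK.
  have c22 : sigma 2 * sigma 2 * (c^-1 * c^-1) = a * a.
    by rewrite -mulgA (mulgA _ c^-1) c2 mulgA -ca2 -mulgA c2.
  by rewrite /x mulgA c22; gsimp.
pose l0 := [:: rho 0 / b; rho 1 / b; (rho 1 / b) ^ b^-1].
pose B := generated [set` l0].
have Bgrp : is_subgroup B by exact: generated_subgroup.
have B0 : B (rho 0 / b) by apply: mem_generated; rewrite /= !inE eqxx.
have B1 : B (rho 1 / b) by apply: mem_generated; rewrite /= !inE eqxx orbT.
have B1V : B ((rho 1 / b) ^ b^-1) by apply: mem_generated; rewrite /= !inE eqxx !orbT.
have [B1b B1V2] := braid_conj_stable Bgrp (esym (@rho_braid 4 1 isT)) B1 B1V.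
have Bstable g : g = b \/ g = b^-1 -> conj_stable g B.
  move=> gb; apply: generated_conj => // y /=; rewrite !inE => /or3P[] /eqP ->.
  - by case: gb => ->; rewrite commute_conj //; apply: commuteV.
  - by case: gb => ->.
  - by case: gb => ->; rewrite ?conjgKV.
have BH : B `<=` H.
  apply: generated_sub => // y /=; rewrite !inE => /or3P[] /eqP -> //.
    by rewrite r1E; apply: Hr0x.
  (* Writing [rho 1 / b] by [r0x] already costs one conjugation by [b^-1]; the further one here is
     why [l'] contains the double conjugates. *)
  rewrite r1E r0x 2!conjMg conjVg (commute_conj (commuteV cr0b)).
  apply: (subM Hgrp); last exact: HA2.
  by apply: (subM Hgrp) => //; apply: (subV Hgrp); apply: HA1.
exists [set` l']; first by apply/finite_seqP; exists l'.
apply/seteqP; split.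
  apply: generated_sub; first exact: derived_subgroup.
  have lG y : y \in l -> derived [set: GVB 4] y.
    rewrite !inE => /or3P[] /eqP ->; last exact: sigma_divg_derived.
      exact: sigma_divg_derived.
    by apply: derived_stable; apply: sigma_divg_derived.
  move=> y /=; rewrite !mem_cat mem_seq1.
  case/or4P => [/lG //|/mapP[z /lG Gz ->]|/mapP[z /lG Gz ->]|/eqP->].
  - exact: derived_stable.
  - by do 2!apply: derived_stable.
  - exact: rho_divg_derived.
apply: (@derived_sub_stable 4 2 H B) => //;
  try by [apply: Hstable; auto|apply: Bstable; auto].
- by case=> [|[|[|i]]] // _; [rewrite mulgV; apply: (sub1 Hgrp)|exact: HA0|exact: HA0].
- by case=> [|[|[|i]]] // _; rewrite mulgV; apply: (sub1 Bgrp).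
Qed.
End FourStrands.

(** Modulo the second derived subgroup all [sigma]s coincide and all [rho]s coincide; as [sigma 0]
    and [rho 3] commute, that quotient is abelian. *)
Lemma perfect_derived_GVB n : 5 <= n -> perfect (derived [set: GVB n]).
Proof.
move=> n5; have n3 : 3 < n.-1 by case: n n5.
have n0 : 0 < n.-1 by apply: leq_trans n3.
have Gstable g := @derived_stable n g.
apply/seteqP; split; last by apply: derived_sub; exact: derived_subgroup.
have Nstable g : conj_stable g (derived (derived [set: GVB n])).
  exact: derived_conj_stable.
apply: (derived_sub_quotient (a := sigma n 0) (b := rho n 3)) => //.
- exact: derived_subgroup.
- exact: sigma_rhoC.
- move=> i lti; apply: (braid_divg_derived2 _ _ n3 lti n0) => k.
    exact: sigma_braid.
  exact: sigmaC.
- move=> i lti; apply: (braid_divg_derived2 _ _ n3 lti n3) => k.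
    exact: rho_braid.
  exact: rhoC.
Qed.

(** * The affine group of a line *)

Section Affine.
Context (K : fieldType).
Local Open Scope ring_scope.

(* [(u, v)] stands for the affine map [x |-> u * x + v]. *)
Definition affine := {p : K * K | p.1 != 0}.
HB.instance Definition _ := Choice.on affine.

Definition affine_of (u v : K) (u0 : u != 0) : affine := exist _ (u, v) u0.

Definition affine_one : affine := affine_of 0 (oner_neq0 K).
Definition affine_mul (f g : affine) : affine :=
  affine_of ((val f).1 * (val g).2 + (val f).2) (mulf_neq0 (valP f) (valP g)).
Fact affine_inv_subproof (f : affine) : (val f).1^-1 != 0.
Proof. by rewrite invr_eq0; exact: (valP f). Qed.
Definition affine_inv (f : affine) : affine :=
  affine_of (- ((val f).1^-1 * (val f).2)) (affine_inv_subproof f).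

Lemma affine_mulA : associative affine_mul.
Proof. by move=> f g h; apply: val_inj; rewrite /= mulrA mulrDr addrA mulrA. Qed.
Lemma affine_mul1 : left_id affine_one affine_mul.
Proof. by move=> [[u v] u0]; apply: val_inj; rewrite /= !mul1r addr0. Qed.
Lemma affine_mulr1 : right_id affine_one affine_mul.
Proof. by move=> [[u v] u0]; apply: val_inj; rewrite /= mulr1 mulr0 add0r. Qed.
Lemma affine_mulV : left_inverse affine_one affine_inv affine_mul.
Proof. by move=> [[u v] u0]; apply: val_inj; rewrite /= mulVf // subrr. Qed.
Lemma affine_mulrV : right_inverse affine_one affine_inv affine_mul.
Proof.
by move=> [[u v] u0]; apply: val_inj; rewrite /= mulrN mulrA mulfV // mul1r addNr.
Qed.

HB.instance Definition _ := isGroup.Build affine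
  affine_mulA affine_mul1 affine_mulr1 affine_mulV affine_mulrV.

Lemma affine_mulE (f g : affine) :
  val (f * g)%g = ((val f).1 * (val g).1, (val f).1 * (val g).2 + (val f).2).
Proof. by []. Qed.

Lemma affine_invE (f : affine) :
  val f^-1%g = ((val f).1^-1, - ((val f).1^-1 * (val f).2)).
Proof. by []. Qed.

(** Linear parts commute, so a translation remains; it is trivial when both entries are
    translations, which is why second derived subgroups die. *)
Lemma affine_commgE (f g : affine) :
  val [~ f, g]%g =
    (1, (val f).1^-1 * (val g).1^-1 *
      (((val f).1 - 1) * (val g).2 - ((val g).1 - 1) * (val f).2)).
Proof.
rewrite commgEl conjgE !affine_mulE !affine_invE /=.
have f0 := valP f; have g0 := valP g.
by congr pair; field; rewrite f0 g0.
Qed.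

Definition translations (P : set K) : set affine :=
  [set f | (val f).1 = 1 /\ P (val f).2].

Lemma translations_subgroup (P : set K) :
  P 0 -> (forall x y, P x -> P y -> P (x + y)) -> (forall x, P x -> P (- x)) ->
  is_subgroup (translations P).
Proof.
move=> P0 PD PN; apply/is_subgroupP; split=> //= [f g [f1 Pf] [g1 Pg]|f [f1 Pf]].
  by rewrite /translations /= f1 g1 !mul1r addrC; split; last exact: PD.
by rewrite /translations /= f1 invr1 mul1r; split; last exact: PN.
Qed.

End Affine.

Lemma hom_one (G G' : groupType) (phi : G -> G') :
  (forall x y, phi (x * y) = phi x * phi y) -> phi 1 = 1.
Proof. by move=> phiM; apply: (mulgI (phi 1)); rewrite -phiM !mulg1. Qed.

Lemma preim_subgroup (G G' : groupType) (phi : G -> G') (H : set G') :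
  (forall x y, phi (x * y) = phi x * phi y) -> is_subgroup H ->
  is_subgroup [set x | H (phi x)].
Proof.
move=> phiM Hgrp; apply/is_subgroupP; split=> /= [|x y Hx Hy|x Hx].
- by rewrite (hom_one phiM); apply: sub1.
- by rewrite phiM; apply: subM.
- suff ->: phi x^-1 = (phi x)^-1 by apply: subV.
  by apply: (mulgI (phi x)); rewrite -phiM !mulgV (hom_one phiM).
Qed.

Lemma hom_commg (G G' : groupType) (phi : G -> G') (x y : G) :
  (forall x y, phi (x * y) = phi x * phi y) -> phi [~ x, y] = [~ phi x, phi y].
Proof.
move=> phiM; apply: (mulgI (phi y * phi x)).
by rewrite -commgC -!phiM -commgC.
Qed.

(** * Failure of perfectness for three and four strands *)

Section TrefoilColoring.
Context (n : nat).

Definition reflection (v : 'F_3) : affine 'F_3 := @affine_of 'F_3 (-1)%R v isT.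

(** Neighbouring [sigma]s get distinct reflections, whose product has order 3, hence the braid
    relation. For [n <= 4] the only far indices are 0 and 2, which share a parity and so a
    reflection. *)
Definition coloring (x : gvb_letter n) : affine 'F_3 :=
  if x is inl i then reflection (odd i)%:R%R else 1.

Lemma coloring_rel : n <= 4 -> forall u v, gvb_rel u v ->
  word_eval coloring u = word_eval coloring v.
Proof.
move=> n4 u v []; rewrite /word_eval => i j.
all: rewrite !big_cons big_nil /= ?mul1g ?mulg1 //.
- move=> fij; suff ->: odd i = odd j by [].
  move: (ltn_ord i) (ltn_ord j) fij; rewrite /far.
  case: n n4 i j => [|[|[|[|[|m]]]]] //= _ [[|[|[|i]]] /= +] [[|[|[|j]]] /= +] //.
- by move=> ->; apply: val_inj; rewrite /=; case: (odd i); apply/eqP.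
Qed.

End TrefoilColoring.

Lemma derived_hom_translations (G : groupType) (K : fieldType)
    (phi : G -> affine K) :
  (forall x y, phi (x * y) = phi x * phi y) ->
  forall x, derived [set: G] x -> (val (phi x)).1 = 1%R.
Proof.
move=> phiM x Gx.
suff [] : translations setT (phi x) by [].
move: x Gx; apply: (@generated_sub _ _ [set x | translations setT (phi x)]).
  exact/(preim_subgroup phiM)/translations_subgroup.
by move=> _ [x _] [y _ <-]; split; rewrite // hom_commg // affine_commgE.
Qed.

Lemma not_perfect_derived_GVB n : 3 <= n <= 4 -> ~ perfect (derived [set: GVB n]).
Proof.
move=> /andP[n3 n4] perf.
pose phi := pres_lift (R := @gvb_rel n) (@coloring n).
have phiM : forall x y, phi (x * y) = phi x * phi y.
  by apply: pres_liftM; exact: coloring_rel.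
have phi0 x : derived (derived [set: GVB n]) x -> translations [set 0%R] (phi x).
  move: x; apply: (@generated_sub _ _ [set x | translations [set 0%R] (phi x)]).
    apply/(preim_subgroup phiM)/translations_subgroup => [|x y -> ->|x ->] //=.
    - exact: addr0.
    - exact: oppr0.
  move=> _ [x Gx] [y Gy <-]; split; rewrite hom_commg // affine_commgE //=.
  by rewrite !(derived_hom_translations phiM) // subrr !mul0r subrr mulr0.
have n2 : 1 < n.-1 by case: n n3 {n4 perf phi phiM phi0} => [|[]].
(* This commutator maps to a nonzero translation, yet perfectness would put it in the second derived
   subgroup. *)
have := @mem_derived _ [set: GVB n] (sigma n 0) (sigma n 1) I I.
rewrite perf => /phi0[_]; rewrite hom_commg // affine_commgE.
rewrite -[0]/(val (Ordinal (ltnW n2))) -[1%N]/(val (Ordinal n2)) !sigma_ord.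
rewrite /phi !(pres_lift_letter (coloring_rel n4)).
by move/eqP.
Qed.

(** * Infinite generation for three strands *)

Section DoublingAction.
Local Open Scope ring_scope.

Lemma rat2_neq0 : 2 != 0 :> rat. Proof. by []. Qed.
Lemma ratN1_neq0 : -1 != 0 :> rat. Proof. by []. Qed.

(** Both [sigma]s share one image, and so do both [rho]s, which settles the braid relations. The
    mixed ones hold since [x |-> 1 - x] is an involution, and with three strands there are no far
    indices. *)
Definition doubling (x : gvb_letter 3) : affine rat :=
  if x is inl _ then affine_of 1 ratN1_neq0 else affine_of 0 rat2_neq0.

Lemma doubling_rel u v : @gvb_rel 3 u v ->
  word_eval doubling u = word_eval doubling v.
Proof.
case=> i j ij; rewrite /word_eval !big_cons big_nil //; apply/val_inj/eqP => //.
by case: i j ij => [[|[|i]] //= ?] [[|[|j]] //= ?].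
Qed.

(* [1 - 2^-k] occurs as a translation length for every [k]. *)
Lemma not_finitely_generated_derived_GVB3 :
  ~ finitely_generated (derived [set: GVB 3]).
Proof.
case=> A /finite_seqP[s ->] gens.
pose phi := pres_lift (R := @gvb_rel 3) doubling.
have phiM : forall x y, phi (x * y)%g = (phi x * phi y)%g.
  by apply: pres_liftM; exact: doubling_rel.
pose t x : rat := (val (phi x)).2.
(* A common denominator for the translation lengths of the supposed generators, hence of the whole
   derived subgroup. *)
pose d : int := \prod_(x <- s) denq (t x).
have d0 : d != 0 by rewrite prodf_seq_neq0; apply/allP => x _; exact: denq_neq0.
pose P := [set q : rat | d%:~R * q \is a Num.int].
have Psub : is_subgroup (translations P).
  apply: translations_subgroup => [|x y|x]; rewrite /P /=.
  - by rewrite mulr0 rpred0.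
  - by rewrite mulrDr; exact: rpredD.
  - by rewrite mulrN rpredN.
have GP x : derived [set: GVB 3] x -> P (t x).
  rewrite -{1}gens.
  suff sub : generated [set` s] `<=` [set x | translations P (phi x)].
    by move=> /sub[].
  apply: generated_sub; first exact: preim_subgroup.
  move=> y /= ys; split.
    by apply: derived_hom_translations => //; rewrite -gens; exact: mem_generated.
  rewrite /P /= /d (perm_big _ (perm_to_rem ys)) big_cons /= mulrC rmorphM /=.
  rewrite mulrA -{1}[(val _).2]divq_num_den divfK ?intr_eq0 ?denq_neq0 //.
  by rewrite -rmorphM intr_int.
have s0 : val (phi (sigma 3 0)) = (-1, 1).
  rewrite -[0%N]/(val (@Ordinal 2 0 isT)) sigma_ord.
  by rewrite /phi (pres_lift_letter (@doubling_rel)).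
have r0 : val (phi (rho 3 0)) = (2, 0).
  rewrite -[0%N]/(val (@Ordinal 2 0 isT)) rho_ord.
  by rewrite /phi (pres_lift_letter (@doubling_rel)).
have powers k : exists g, val (phi g) = (2 ^+ k, 0).
  elim: k => [|k [g IHk]]; first by exists 1%g; rewrite hom_one.
  by exists (rho 3 0 * g)%g; rewrite phiM affine_mulE r0 IHk exprS mulr0 add0r.
(* With this exponent, integrality of [d * (1 - 2^-|d|)] makes [2^|d|] divide the nonzero [d],
   against [|d| < 2^|d|]. *)
have [g gk] := powers `|d|%N.
have := GP _ (@mem_derived _ [set: GVB 3] (sigma 3 0) g I I).
rewrite /P /t /mkset hom_commg // affine_commgE s0 gk /=.
move dm: (absz d) => m.
have m0 : (2 ^+ m : rat) != 0 by rewrite expf_neq0.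
set q := _ * _; have -> : q = d%:~R - d%:~R / 2 ^+ m.
  rewrite /q; move: (2 ^+ m) m0 => p p0; field; exact: p0.
rewrite rpredBl ?intr_int // => /intrP[z zE].
have dz : d = z * 2 ^+ m.
  by apply: (@intr_inj rat); rewrite rmorphM /= -zE rmorphXn /= divfK.
have zm : m = (absz z * 2 ^ m)%N by rewrite -[LHS]dm dz abszM abszX.
have z0 : (0 < absz z)%N.
  by rewrite absz_gt0; apply: contra d0 => /eqP z0; rewrite dz z0 mul0r.
have := ltn_expl m (isT : (1 < 2)%N).
by rewrite {1}zm ltnNge leq_pmull.
Qed.

End DoublingAction.

Local Close Scope group_scope.

Theorem theorem1p2 (n : nat) (hn : 3 <= n) :
  ((4 <= n -> finitely_generated (derived [set: GVB n])) /\
   (5 <= n -> exists2 r, is_rank (derived [set: GVB n]) r & r <= 3 * n - 7)) /\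
  ~ finitely_generated (derived [set: GVB 3]) /\
  (perfect (derived [set: GVB n]) <-> 5 <= n).
Proof.
split; [split|split].
- rewrite leq_eqVlt => /orP[/eqP <-|n5].
    exact: finitely_generated_derived_GVB4.
  exists [set` derived_gens5 n]; last exact: generated_derived_gens5.
  by apply/finite_seqP; exists (derived_gens5 n).
- move=> n5; have [r rk rs] := finitely_generated_rank (generated_derived_gens5 n5).
  by exists r => //; apply: leq_trans rs (size_derived_gens5 n5).
- exact: not_finitely_generated_derived_GVB3.
- split=> [perf|]; last exact: perfect_derived_GVB.
  rewrite ltnNge; apply/negP => n4.
  by apply: (@not_perfect_derived_GVB n); rewrite ?hn.
Qed.
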